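(* Let $A$ be an associative algebra over an algebraically closed field $\mathbb{F}$ of characteristic zero with a nondegenerate regular $G$-grading, $G$ a finite group, whose commutation function $\theta$ satisfies $\theta_{g,g}=1$ for every $g\in G$. Then the associated twisted group algebra $\mathbb{F}^\alpha G$ is isomorphic to $M_r(\mathbb{F})$, where $|G|=r^2$, so that the commutation matrix $M_G$, whose entries lie in $\mathbb{F}^\alpha G\cong M_r(\mathbb{F})$, may be viewed as a matrix in $M_{r^3}(\mathbb{F})$; and $\det(M_G)=\pm r^{(r^3)}$.
   Context: For $\bar g=(g_1,\dots,g_n)\in G^n$ let $Sym(\bar g)=\{\sigma\in Sym(n): g_1\cdots g_n=g_{\sigma(1)}\cdots g_{\sigma(n)}\}$. A $G$-grading $A=\bigoplus_{g\in G}A_g$ (with $A_gA_h\subseteq A_{gh}$) is regular, with commutation function $\theta$, if: for every $n\geq 1$, $\bar g\in G^n$, $\sigma\in Sym(\bar g)$ there is $\theta_{(\bar g,\sigma)}\in\mathbb{F}^\times$ with $a_1\cdots a_n=\theta_{(\bar g,\sigma)}a_{\sigma(1)}\cdots a_{\sigma(n)}$ for all $a_i\in A_{g_i}$; and for every $n\geq 1$, $\bar g\in G^n$ there are $a_i\in A_{g_i}$ with $a_1\cdots a_n\ne0$. For commuting $g,h$ write $\theta_{g,h}=\theta_{((g,h),(1\,2))}$. The grading is nondegenerate if for every $e\ne g\in G$ there is $g'\in C_G(g)$ with $\theta_{g,g'}\neq1$. When $\theta_{g,g}=1$ for all $g$, there is a 2-cocycle $\alpha\in Z^2(G,\mathbb{F}^\times)$,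 unique up to coboundaries, such that the twisted group algebra $\mathbb{F}^\alpha G$ (basis $\{U_g\}_{g\in G}$, product $U_gU_h=\alpha(g,h)U_{gh}$, natural $G$-grading, which is regular) has commutation function $\theta$. The commutation matrix $M_G$ is the $|G|\times|G|$ matrix over $\mathbb{F}^\alpha G$ with entries $(M_G)_{g,h}=U_gU_hU_g^{-1}U_h^{-1}$. *)

(* Defs.v *)
From HB Require Import structures.
From mathcomp Require Import all_boot all_order all_algebra.
From mathcomp Require Import all_fingroup all_field.

Set Implicit Arguments.
Unset Strict Implicit.
Unset Printing Implicit Defensive.

Import GRing.Theory.
Local Open Scope ring_scope.

(* Only the values [th n gs s] with [0 < n] and [s \in reorderings gs] are     *)
(* meaningful; the others are junk that no definition below looks at.         *)
Definition commutation_function (F : fieldType) (G : finGroupType) : Type :=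
  forall n : nat, n.-tuple G -> 'S_n -> F.

Definition reorderings (G : finGroupType) n (gs : n.-tuple G) : {set 'S_n} :=
  [set s : 'S_n |
    (\prod_(i < n) tnth gs i)%g == (\prod_(i < n) tnth gs (s i))%g].

Section RegularGrading.

Variables (F : fieldType) (G : finGroupType) (A : algType F).

Record is_grading (A_ : G -> {pred A}) : Prop := IsGrading {
  grading_submod : forall g, submod_closed (A_ g);
  grading_direct : forall a : A, exists! c : {ffun G -> A},
    (forall g, c g \in A_ g) /\ a = \sum_g c g;
  grading_mul : forall g h a b, a \in A_ g -> b \in A_ h -> a * b \in A_ (g * h)%g
}.

Record is_regular_grading (A_ : G -> {pred A})
    (th : commutation_function F G) : Prop := IsRegularGrading {
  regular_grading : is_grading A_;
  regular_comm : forall n (gs : n.-tuple G) (s : 'S_n), (0 < n)%N ->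
    s \in reorderings gs ->
    th n gs s != 0 /\
    (forall a : 'I_n -> A, (forall i, a i \in A_ (tnth gs i)) ->
      \prod_(i < n) a i = th n gs s *: \prod_(i < n) a (s i));
  regular_neq0 : forall n (gs : n.-tuple G), (0 < n)%N ->
    exists2 a : 'I_n -> A, (forall i, a i \in A_ (tnth gs i)) &
      \prod_(i < n) a i != 0
}.

End RegularGrading.

(* theta_(g,h); meaningful when g and h commute.                              *)
Definition comm2 (F : fieldType) (G : finGroupType)
    (th : commutation_function F G) (g h : G) : F :=
  th 2%N [tuple g; h] (tperm ord0 ord_max).

Definition nondegenerate_commutation (F : fieldType) (G : finGroupType)
    (th : commutation_function F G) : Prop :=
  forall g : G, g != 1%g -> exists2 g' : G, g' \in 'C[g]%g & comm2 th g g' != 1.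

(* Elements of Z^2(G, F^* ) for the trivial action; not assumed normalized.   *)
Record cocycle2 (F : fieldType) (G : finGroupType) := Cocycle2 {
  cocycle2_val :> G -> G -> F;
  cocycle2_neq0 : forall g h, cocycle2_val g h != 0;
  cocycle2P : forall g h k,
    cocycle2_val g h * cocycle2_val (g * h)%g k =
    cocycle2_val h k * cocycle2_val g (h * k)%g
}.

(* The twisted group algebra: x stands for \sum_g x g *: U_g. This is an      *)
(* alias, so that the pointwise product of {ffun G -> F} is not inherited.    *)
Definition twisted (F : fieldType) (G : finGroupType) (al : cocycle2 F G) :
  Type := {ffun G -> F^o}.

Section Twisted.

Variables (F : fieldType) (G : finGroupType) (al : cocycle2 F G).
Local Notation T := (twisted al).

HB.instance Definition _ := Vector.copy T {ffun G -> F^o}.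

Definition tw_basis (g : G) : T := [ffun h => (h == g)%:R].
Local Notation U := tw_basis.

Definition tw_mul (x y : T) : T :=
  \sum_g \sum_h (x g * y h * al g h) *: U (g * h)%g.

(* As the cocycle need not be normalized, U_1 is only a multiple of the unit. *)
Definition tw_one : T := (al 1%g 1%g)^-1 *: U 1%g.

Lemma tw_expand (x : T) : x = \sum_g x g *: U g.
Proof.
apply/ffunP => h; rewrite sum_ffunE (bigD1 h) //= big1 => [|g ne_gh].
  by rewrite !ffunE eqxx addr0 /GRing.scale /= mulr1.
by rewrite !ffunE eq_sym (negPf ne_gh) /GRing.scale /= mulr0.
Qed.

Fact tw_mulDl : left_distributive tw_mul +%R.
Proof.
move=> x y z; rewrite /tw_mul -big_split; apply: eq_bigr => g _ /=.
by rewrite -big_split; apply: eq_bigr => h _ /=; rewrite ffunE !mulrDl scalerDl.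
Qed.

Fact tw_mulDr : right_distributive tw_mul +%R.
Proof.
move=> x y z; rewrite /tw_mul -big_split; apply: eq_bigr => g _ /=.
rewrite -big_split; apply: eq_bigr => h _ /=.
by rewrite ffunE mulrDr mulrDl scalerDl.
Qed.

Fact tw_scalerAl a (x y : T) : a *: tw_mul x y = tw_mul (a *: x) y.
Proof.
rewrite /tw_mul scaler_sumr; apply: eq_bigr => g _.
rewrite scaler_sumr; apply: eq_bigr => h _.
by rewrite scalerA !ffunE /GRing.scale /= !mulrA.
Qed.

Fact tw_scalerAr a (x y : T) : a *: tw_mul x y = tw_mul x (a *: y).
Proof.
rewrite /tw_mul scaler_sumr; apply: eq_bigr => g _.
rewrite scaler_sumr; apply: eq_bigr => h _.
by rewrite scalerA !ffunE /GRing.scale /= !mulrA (mulrC a).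
Qed.

Fact tw_mulUU g h : tw_mul (U g) (U h) = al g h *: U (g * h)%g.
Proof.
rewrite /tw_mul (bigD1 g) //= (bigD1 h) //= !ffunE !eqxx !mul1r.
rewrite !big1 ?addr0 // => [k ne_kg | k ne_kh].
  by rewrite big1 // => l _; rewrite !ffunE (negPf ne_kg) !mul0r scale0r.
by rewrite !ffunE (negPf ne_kh) mulr0 mul0r scale0r.
Qed.

Fact tw_mul_suml I (r : seq I) (P : pred I) (f : I -> T) y :
  tw_mul (\sum_(i <- r | P i) f i) y = \sum_(i <- r | P i) tw_mul (f i) y.
Proof.
apply: (big_morph (tw_mul^~ y) (fun x z => tw_mulDl x z y)).
by rewrite -{1}(scale0r (0 : T)) -tw_scalerAl scale0r.
Qed.

Fact tw_mul_sumr I (r : seq I) (P : pred I) (f : I -> T) x :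
  tw_mul x (\sum_(i <- r | P i) f i) = \sum_(i <- r | P i) tw_mul x (f i).
Proof.
apply: (big_morph (tw_mul x) (tw_mulDr x)).
by rewrite -{1}(scale0r (0 : T)) -tw_scalerAr scale0r.
Qed.

Fact tw_mulA : associative tw_mul.
Proof.
move=> x y z.
have lsum c (e : G -> T) w : tw_mul (\sum_g c g *: e g) w
    = \sum_g c g *: tw_mul (e g) w.
  by rewrite tw_mul_suml; apply: eq_bigr => g _; rewrite tw_scalerAl.
have rsum c (e : G -> T) w : tw_mul w (\sum_g c g *: e g)
    = \sum_g c g *: tw_mul w (e g).
  by rewrite tw_mul_sumr; apply: eq_bigr => g _; rewrite tw_scalerAr.
rewrite [in LHS](tw_expand x) [in RHS](tw_expand x) 2!lsum.
rewrite [in RHS]lsum.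
apply: eq_bigr => g _; congr (_ *: _).
rewrite [in LHS](tw_expand y) [in RHS](tw_expand y) lsum !rsum lsum.
apply: eq_bigr => h _; congr (_ *: _).
rewrite [in LHS](tw_expand z) [in RHS](tw_expand z) !rsum.
apply: eq_bigr => k _; congr (_ *: _).
rewrite !tw_mulUU -tw_scalerAr -tw_scalerAl !tw_mulUU !scalerA.
by rewrite -cocycle2P mulgA.
Qed.

Fact tw_mul1x : left_id tw_one tw_mul.
Proof.
move=> x; rewrite {2}(tw_expand x) {1}(tw_expand x) tw_mul_sumr.
apply: eq_bigr => g _; rewrite -tw_scalerAr -tw_scalerAl tw_mulUU scalerA mul1g.
have := cocycle2P al 1%g 1%g g; rewrite !mul1g => /(mulIf (cocycle2_neq0 al _ _)).
by move<-; rewrite scalerA mulfVK ?cocycle2_neq0.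
Qed.

Fact tw_mulx1 : right_id tw_one tw_mul.
Proof.
move=> x; rewrite {2}(tw_expand x) {1}(tw_expand x) tw_mul_suml.
apply: eq_bigr => g _; rewrite -tw_scalerAl -tw_scalerAr tw_mulUU scalerA mulg1.
have := cocycle2P al g 1%g 1%g; rewrite !mulg1 => /(mulIf (cocycle2_neq0 al _ _)).
by move->; rewrite scalerA mulfVK ?cocycle2_neq0.
Qed.

Fact tw_one_neq0 : tw_one != 0.
Proof.
apply/eqP => /ffunP/(_ 1%g)/eqP; rewrite !ffunE eqxx /GRing.scale /= mulr1.
by rewrite invr_eq0 (negPf (cocycle2_neq0 al _ _)).
Qed.

HB.instance Definition _ := GRing.Zmodule_isNzRing.Build T
  tw_mulA tw_mul1x tw_mulx1 tw_mulDl tw_mulDr tw_one_neq0.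
HB.instance Definition _ := GRing.Lmodule_isLalgebra.Build F T tw_scalerAl.
HB.instance Definition _ := GRing.Lalgebra_isAlgebra.Build F T tw_scalerAr.
HB.instance Definition _ := Algebra_isFalgebra.Build F T.

Lemma tw_basisM g h : U g * U h = al g h *: U (g * h)%g.
Proof. exact: tw_mulUU. Qed.

Lemma tw_basis_unit g : U g \is a GRing.unit.
Proof.
have al0 := cocycle2_neq0 al.
have sc_unit a : a != 0 -> a *: U 1%g \is a GRing.unit.
  move=> a0; have ->: a *: U 1%g = (a * al 1%g 1%g)%:A.
    by rewrite -[1]/tw_one /tw_one scalerA mulfK.
  by rewrite scaler_unit ?unitr1 // unitfE mulf_neq0.
apply/unitrP; have Ul := sc_unit _ (al0 g^-1%g g); have Ur := sc_unit _ (al0 g g^-1%g).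
pose l := (al g^-1%g g *: U 1%g)^-1 * U g^-1%g.
pose r := U g^-1%g * (al g g^-1%g *: U 1%g)^-1.
have lg : l * U g = 1 by rewrite -mulrA tw_basisM mulVg mulVr.
have gr : U g * r = 1 by rewrite mulrA tw_basisM mulgV divrr.
have lr : l = r by rewrite -[l]mulr1 -gr mulrA lg mul1r.
by exists l; rewrite {2}lr.
Qed.

Definition tw_component (g : G) : {pred T} := [pred x : T | x \in <[U g]>%VS].

(* Rows and columns are listed in the same order [enum G], so that \det does  *)
(* not depend on the chosen enumeration.                                      *)
Definition commutation_matrix : 'M[T]_#|G| :=
  \matrix_(i, j) (U (enum_val i) * U (enum_val j)
                  * (U (enum_val i))^-1 * (U (enum_val j))^-1).

End Twisted.

Lemma sum_block_size (m r : nat) :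
  m = (r ^ 2)%N -> (\sum_(i < m) r)%N = (r ^ 3)%N.
Proof. by move->; rewrite sum_nat_const card_ord -expnSr. Qed.

(* A matrix of order r^2 over an algebra T, seen through f : T -> 'M_r as a   *)
(* block matrix of order r^3.                                                 *)
Definition block_matrix (F : fieldType) (T : Type) (m r : nat)
    (mr : m = (r ^ 2)%N) (f : T -> 'M[F]_r) (M : 'M[T]_m) : 'M[F]_(r ^ 3) :=
  castmx (sum_block_size mr, sum_block_size mr)
    (\mxblock_(i < m, j < m) f (M i j)).

(* Main.v *)
Require Import Defs.
From HB Require Import structures.
From mathcomp Require Import all_boot all_order all_algebra.
From mathcomp Require Import all_fingroup all_field.

Set Implicit Arguments.
Unset Strict Implicit.
Unset Printing Implicit Defensive.

Import GRing.Theory.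
Local Open Scope ring_scope.

(** Write U_g for the basis of the twisted group algebra T. Everything rests on
    a vanishing sum. For x != 1, nondegeneracy provides y commuting with x such
    that U_y and U_x commute only up to a scalar c != 1. Replacing h by h y in
    the sum over h of U_h U_x U_h^-1 multiplies that sum by a scalar other than
    1, hence the sum is 0 (sum_conj_tw_basis).

    The (g, k) entry of the square of the commutation matrix M is
      U_g (\sum_h U_h (U_g^-1 U_k) U_h^-1) U_k^-1,
    and U_g^-1 U_k is a multiple of the basis element at g^-1 k. So the entry
    vanishes for g != k and equals |G| for g = k: M squares to |G|
    (commutation_matrix_sqr). Seen as a matrix D of order r^3 over the field
    through an isomorphism of T with the r x r matrices, it still squares to
    |G| = r^2, so (det D)^2 = r^(2 r^3), which fixes det D up to sign.

    For the isomorphism itself, one works with projective representations rho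
    of G with cocycle alpha, which are the representations of T. Over an
    algebraically closed field there is one in which Schur's lemma holds: as
    long as some matrix commuting with rho is not scalar, its eigenspaces are
    proper subrepresentations (exists_schur_rep). Averaging any matrix over
    G by conjugation then gives a scalar, determined by its trace because the
    degree is invertible in characteristic zero; read entry
    by entry on the matrix units, this says that every matrix is a combination
    of the rho g, with coefficients given by traces
    (projective_rep_expansion). This is surjectivity of T -> M_r. Conversely
    nondegeneracy forces tr (rho x) = 0 for x != 1, by the same commutation up
    to c, so the same traces recover the coordinates of an element of T from
    its image, which is injectivity. Comparing both trace formulas on the
    single matrix rho 1 yields |G| = r^2. *)

(** * The square of the commutation matrix *)

(** The condition that no x != 1 is regular for the cocycle, in terms of
    alpha alone: as U_x U_y = alpha(x,y) U_(xy), comparing alpha(x,y) with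
    alpha(y,x) is comparing theta_(x,y) with 1. *)
Definition nondegenerate_cocycle (F : fieldType) (G : finGroupType)
    (al : cocycle2 F G) : Prop :=
  forall x : G, x != 1%g -> exists2 y : G, commute x y & al x y != al y x.

Lemma nondegenerate_cocycleP (F : fieldType) (G : finGroupType)
    (al : cocycle2 F G) (th : commutation_function F G) :
  is_regular_grading (tw_component (al := al)) th ->
  nondegenerate_commutation th -> nondegenerate_cocycle al.
Proof.
move=> regT nd x /nd [y /cent1P cxy th_xy]; exists y => //.
apply: contraNneq th_xy => al_xy; apply/eqP.
pose gs := [tuple x; y]; pose s : 'S_2 := tperm ord0 ord_max.
have s_gs : s \in reorderings gs.
  rewrite inE !big_ord_recl !big_ord0 /= !mulg1.
  have -> : lift ord0 ord0 = ord_max :> 'I_2 by exact: val_inj.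
  by rewrite tpermL tpermR; apply/eqP.
have [_ thP] := regular_comm regT (n := 2) isT s_gs.
have := thP (fun i => tw_basis al (tnth gs i)) (fun i => memv_line _).
rewrite !big_ord_recl !big_ord0 /= !mulr1.
have -> : lift ord0 ord0 = ord_max :> 'I_2 by exact: val_inj.
rewrite tpermL tpermR !(tnth_nth 1%g) /= !tw_basisM cxy al_xy scalerA.
move/ffunP/(_ (x * y)%g); rewrite !ffunE eqxx /GRing.scale /= !mulr1.
by rewrite -{1}[al y x]mul1r => /(mulIf (cocycle2_neq0 al y x))/esym.
Qed.

Section Averaging.

Variables (F : fieldType) (G : finGroupType) (al : cocycle2 F G).
Local Notation U := (tw_basis al).

(** Conjugation by U_(h y) is conjugation by U_y followed by conjugation by U_h,
    and the first multiplies U_x by a scalar. For y commuting with x and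
    alpha(x,y) != alpha(y,x) that scalar is not 1, while reindexing leaves the
    sum unchanged. *)
Lemma sum_conj_tw_basis x : nondegenerate_cocycle al -> x != 1%g ->
  \sum_h U h * U x * (U h)^-1 = 0.
Proof.
move=> nd /nd [y cxy al_xy]; set S := LHS.
have UU := tw_basis_unit al.
have shift h : al x y *: (U (h * y)%g * U x * (U (h * y)%g)^-1)
    = al y x *: (U h * U x * (U h)^-1).
  apply: (mulIr (UU (h * y)%g)); apply: (scalerI (cocycle2_neq0 al h y)).
  transitivity (al x y *: (U h * U y * U x)).
    by rewrite -!scalerAl mulrVK // (tw_basisM al h y) -scalerAl !scalerA mulrC.
  transitivity (al y x *: (U h * U x * (U h)^-1 * (U h * U y))).
    by rewrite !mulrA mulrVK // -!mulrA !tw_basisM -!scalerAr !scalerA cxy mulrC.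
  by rewrite (tw_basisM al h y) -scalerAr -scalerAl !scalerA mulrC.
have /eqP: (al x y - al y x) *: S = 0.
  rewrite scalerBl {1}/S (reindex_inj (mulIg y)) /= !scaler_sumr -sumrB big1 //.
  by move=> h _; rewrite shift subrr.
by rewrite scaler_eq0 subr_eq0 (negPf al_xy) => /eqP.
Qed.

(** In the product of the (g, h) and (h, k) entries the inner factors
    U_h^-1 U_h cancel, which leaves a conjugate of U_g^-1 U_k by U_h. *)
Lemma commutation_matrix_sqr : nondegenerate_cocycle al ->
  commutation_matrix al *m commutation_matrix al = (#|G|%:R)%:M.
Proof.
move=> nd; have UU := tw_basis_unit al.
apply/matrixP => i k; rewrite !mxE; set g := enum_val i.
transitivity (U g * (\sum_h U h * ((U g)^-1 * U (enum_val k)) * (U h)^-1)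
              * (U (enum_val k))^-1).
  rewrite mulr_sumr mulr_suml (reindex (@enum_rank G)) /=; last first.
    by exists enum_val => ? _; rewrite (enum_valK, enum_rankK).
  by apply: eq_bigr => h _; rewrite !mxE enum_rankK !mulrA mulrVK.
have [<-|ne_ik] := eqVneq i k.
  rewrite mulVr // (eq_bigr (fun=> 1)) => [|h _]; last by rewrite mulr1 divrr.
  by rewrite sumr_const mulr_natr mulrnAl divrr.
set z := enum_val k; pose x := (g^-1 * z)%g.
have -> : (U g)^-1 * U z = (al g x)^-1 *: U x.
  apply: (mulrI (UU g)); rewrite mulVKr // -scalerAr tw_basisM scalerA.
  by rewrite mulVf ?cocycle2_neq0 // scale1r mulKVg.
have x1 : x != 1%g.
  by rewrite -eq_invg_mul invgK; apply: contraNneq ne_ik => /enum_val_inj ->.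
rewrite (eq_bigr (fun h => (al g x)^-1 *: (U h * U x * (U h)^-1))).
  by rewrite -scaler_sumr sum_conj_tw_basis // scaler0 mulr0 mul0r.
by move=> h _; rewrite -scalerAr -scalerAl.
Qed.

End Averaging.

(** * Block matrices *)

Lemma det_castmx (R : comPzRingType) m n (e : m = n) (A : 'M[R]_m) :
  \det (castmx (e, e) A) = \det A.
Proof. by case: n / e; rewrite castmx_id. Qed.

(** Passing to blocks is multiplicative, so the block matrix squares to the
    scalar a, at order r^3. *)
Lemma det_block_matrix_sqr (F : fieldType) (T : algType F) m r
    (mr : m = (r ^ 2)%N) (phi : {lrmorphism T -> 'M[F]_r}) (M : 'M[T]_m) (a : F) :
  M *m M = a%:A%:M ->
  \det (block_matrix mr phi M) ^+ 2 = a ^+ (r ^ 3).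
Proof.
move=> MM; rewrite /block_matrix det_castmx -(sum_block_size mr) expr2 -det_mulmx.
rewrite mul_mxblock -det_scalar -mxdiagZ; congr (\det _).
apply: eq_mxblock => i k.
transitivity (phi ((M *m M) i k)).
  by rewrite mxE raddf_sum; apply: eq_bigr => j _; apply/esym/rmorphM.
rewrite MM mxE; case: (eqVneq i k) => [_|_].
  by rewrite mulr1n linearZ /= rmorph1 scalemx1 conform_mx_id.
by rewrite mulr0n raddf0.
Qed.

(** * Projective representations *)

Lemma pchar0_natr_inj (R : idomainType) : [pchar R] =i pred0 ->
  injective (fun n : nat => n%:R : R).
Proof.
move/pcharf0P => R0; have le m n : m%:R = n%:R :> R -> (m <= n)%N.
  move=> e; rewrite leqNgt; apply/negP => lt_nm.
  have := R0 (m - n)%N.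
  by rewrite natrB ?(ltnW lt_nm) // e subrr eqxx subn_eq0 leqNgt lt_nm.
by move=> m n e; apply/eqP; rewrite eqn_leq !le.
Qed.

Section ProjectiveRepresentations.

Variables (F : fieldType) (G : finGroupType) (al : cocycle2 F G).

(** The condition at 1 makes the unit of T, a multiple of U_1, act as the
    identity; the product rule alone would also allow rho = 0. *)
Definition projective_rep n (rho : G -> 'M[F]_n) : Prop :=
  rho 1%g = (al 1%g 1%g)%:M /\
  forall g h, rho g *m rho h = al g h *: rho (g * h)%g.

(** The conclusion of Schur's lemma, which is all that is used of
    irreducibility. *)
Definition scalar_commutant n (rho : G -> 'M[F]_n) : Prop :=
  forall A, (forall g, rho g *m A = A *m rho g) -> exists a, A = a%:M.

(** Right multiplication by U_g on T, on row vectors in the basis U. *)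
Definition regular_rep (g : G) : 'M[F]_#|G| :=
  \matrix_(i, j) (al (enum_val i) g *+ (enum_val j == (enum_val i * g)%g)).

Lemma regular_rep_projective : projective_rep regular_rep.
Proof.
split=> [|g h]; apply/matrixP => i k; rewrite !mxE.
  have := cocycle2P al (enum_val i) 1%g 1%g.
  rewrite !mulg1 (inj_eq enum_val_inj) eq_sym.
  by move=> /(mulIf (cocycle2_neq0 _ _ _)) ->.
rewrite (bigD1 (enum_rank (enum_val i * g)%g)) //= big1 ?addr0; last first.
  move=> j ne_j; rewrite !mxE; case: eqP => [e|_]; last by rewrite mulr0n mul0r.
  by rewrite -e enum_valK eqxx in ne_j.
rewrite !mxE !enum_rankK eqxx mulr1n !mulgA mulrnAr.
by rewrite cocycle2P -mulrnAr.
Qed.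

Definition tw_lift n (rho : G -> 'M[F]_n) (x : twisted al) : 'M[F]_n :=
  \sum_g x g *: rho g.

Lemma tw_lift_lrmorphism n (rho : G -> 'M[F]_n) : projective_rep rho ->
  exists phi : {lrmorphism twisted al -> 'M[F]_n}, phi =1 tw_lift rho.
Proof.
move=> [rho1 rhoM].
have lin : linear (tw_lift rho).
  move=> a x y; rewrite /tw_lift scaler_sumr -big_split; apply: eq_bigr => g _ /=.
  by rewrite !ffunE scalerDl scalerA.
have [L LE] : exists L : {linear twisted al -> 'M[F]_n}, L =1 tw_lift rho.
  pose L : {linear twisted al -> 'M[F]_n} :=
    HB.pack (tw_lift rho) (GRing.isLinear.Build _ _ _ _ (tw_lift rho) lin).
  by exists L.
have LU g : L (tw_basis al g) = rho g.
  rewrite LE /tw_lift (bigD1 g) //= ffunE eqxx scale1r big1 ?addr0 // => h ne_hg.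
  by rewrite ffunE (negPf ne_hg) scale0r.
have LUZ a g : L (a *: tw_basis al g) = a *: rho g.
  by rewrite -LU; apply: linearZZ.
have mon : monoid_morphism L.
  split=> [|x y].
    rewrite -[1]/(tw_one al) LUZ rho1 scale_scalar_mx.
    by rewrite mulVf ?cocycle2_neq0.
  rewrite -[x * y]/(tw_mul x y) raddf_sum LE mulr_suml.
  apply: eq_bigr => g _; rewrite raddf_sum LE mulr_sumr.
  apply: eq_bigr => h _; apply: etrans (LUZ _ _) _.
  by rewrite -[RHS]/(_ *m _) -scalemxAl -scalemxAr rhoM !scalerA.
pose phi : {lrmorphism twisted al -> 'M[F]_n} :=
  HB.pack (L : _ -> _) (GRing.isMonoidMorphism.Build _ _ _ mon) L.
by exists phi => x; apply: LE.
Qed.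

Section OneRep.

Variables (n : nat) (rho : G -> 'M[F]_n).
Hypothesis rhoP : projective_rep rho.

Lemma projective_rep_unit g : rho g \in unitmx.
Proof.
have [rho1 rhoM] := rhoP.
suff /mulmx1_unit[] : rho g *m ((al g g^-1%g * al 1%g 1%g)^-1 *: rho g^-1%g) = 1%:M.
  by [].
rewrite -scalemxAr rhoM mulgV rho1 scale_scalar_mx scale_scalar_mx.
by rewrite mulVf // mulf_neq0 ?cocycle2_neq0.
Qed.

(** The restriction of rho to the row space of B, written in the basis formed
    by the rows of B. *)
Lemma projective_subrep m (B : 'M[F]_(m, n)) :
  row_free B -> (forall g, stablemx B (rho g)) ->
  projective_rep (fun g => B *m rho g *m pinvmx B).
Proof.
move=> freeB stB; have [rho1 rhoM] := rhoP.
have BK g : B *m rho g *m pinvmx B *m B = B *m rho g by rewrite mulmxKpV.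
split=> [|g h]; apply: (row_free_inj freeB).
  by rewrite BK rho1 scalar_mxC.
by rewrite -scalemxAl BK -mulmxA BK mulmxA BK -mulmxA rhoM -scalemxAr.
Qed.

Hypothesis al_nd : nondegenerate_cocycle al.

(** The matrix rho x is conjugate, by some rho y, to a multiple of itself by a
    scalar other than 1. *)
Lemma mxtrace_projective_rep x : x != 1%g -> \tr (rho x) = 0.
Proof.
case/al_nd => y cxy al_xy; have [_ rhoM] := rhoP.
have rho_y := projective_rep_unit y.
have e : al y x *: (rho x *m rho y) = al x y *: (rho y *m rho x).
  by rewrite !rhoM cxy !scalerA mulrC.
have /eqP : (al x y - al y x) * \tr (rho x) = 0.
  have t1 : \tr (rho x) = \tr (invmx (rho y) *m (rho x *m rho y)).
    by rewrite mxtrace_mulC -mulmxA mulmxV ?mulmx1.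
  have t2 : \tr (rho x) = \tr (invmx (rho y) *m (rho y *m rho x)).
    by rewrite mulKmx.
  by rewrite mulrBl {1}t2 t1 -!mxtraceZ ![_ *: (invmx _ *m _)]scalemxAr e subrr.
by rewrite mulf_eq0 subr_eq0 (negPf al_xy) => /eqP.
Qed.

Lemma mxtrace_projective_repVM g h :
  \tr (invmx (rho h) *m rho g) = n%:R *+ (g == h).
Proof.
have [_ rhoM] := rhoP; have rho_h := projective_rep_unit h.
have [->|ne_gh] := eqVneq g h; first by rewrite mulVmx // mxtrace1.
have -> : rho g = (al h (h^-1 * g)%g)^-1 *: (rho h *m rho (h^-1 * g)%g).
  by rewrite rhoM scalerA mulVf ?cocycle2_neq0 // scale1r mulKVg.
rewrite -scalemxAr mulKmx // mxtraceZ mxtrace_projective_rep ?mulr0 //.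
by rewrite -eq_invg_mul invgK eq_sym.
Qed.

End OneRep.

Lemma sum_conj_commute n (rho : G -> 'M[F]_n) (M : 'M[F]_n) (g : G) :
  projective_rep rho ->
  let S := \sum_h rho h *m M *m invmx (rho h) in rho g *m S = S *m rho g.
Proof.
move=> rhoP S; have [_ rhoM] := rhoP; have rhoU := projective_rep_unit rhoP.
rewrite {2}/S (reindex_inj (mulgI g)) /= mulmx_sumr mulmx_suml.
apply: eq_bigr => h _.
have rho_g : rho g = rho (g * h)%g *m (al g h *: invmx (rho h)).
  by rewrite -scalemxAr scalemxAl -rhoM mulmxK.
by rewrite [in RHS]rho_g !mulmxA mulmxKV // -scalemxAr !scalemxAl -rhoM.
Qed.

Section SchurRepresentation.

Hypothesis charF : [pchar F] =i pred0.
Variables (r : nat) (rho : G -> 'M[F]_r).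
Hypotheses (r_gt0 : (0 < r)%N) (rhoP : projective_rep rho).
Hypothesis rho_schur : scalar_commutant rho.

Lemma degree_neq0 : r%:R != 0 :> F.
Proof. by rewrite (proj1 (pcharf0P F) charF) -lt0n. Qed.

(** The average commutes with rho, so it is scalar; conjugation preserves the
    trace, which determines the scalar. *)
Lemma sum_conj_projective_rep M :
  \sum_h rho h *m M *m invmx (rho h) = (#|G|%:R * \tr M / r%:R)%:M.
Proof.
have [c Sc] := rho_schur (fun g => sum_conj_commute M g rhoP); rewrite Sc.
congr (_%:M); apply: (mulIf degree_neq0); rewrite mulfVK ?degree_neq0 // mulr_natr.
rewrite -mxtrace_scalar -Sc raddf_sum /= (eq_bigr (fun=> \tr M)) => [|h _].
  by rewrite sumr_const mulr_natl.
by rewrite mxtrace_mulC mulmxA mulVmx ?mul1mx ?projective_rep_unit.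
Qed.

(** Schur orthogonality of the matrix coefficients of rho. The averages of the
    matrix units give the sums over h of (rho h)_(a,i) (rho h)^-1_(j,b), and the
    (a, i) entry of the left-hand side is a combination of these with
    coefficients M_(b,j). *)
Lemma projective_rep_expansion M :
  \sum_h \tr (invmx (rho h) *m M) *: rho h = (#|G|%:R / r%:R) *: M.
Proof.
apply/matrixP => a i; rewrite summxE [RHS]mxE.
transitivity (\sum_j \sum_b M b j *
    (\sum_h rho h *m delta_mx i j *m invmx (rho h)) a b).
  under eq_bigr do rewrite mxE /mxtrace mulr_suml.
  rewrite exchange_big; apply: eq_bigr => j _ /=.
  under eq_bigr do rewrite mxE mulr_suml.
  rewrite exchange_big; apply: eq_bigr => b _ /=.
  rewrite summxE mulr_sumr; apply: eq_bigr => h _.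
  rewrite -(mul_delta_mx (0 : 'I_1)) !mulmxA -mulmxA -colE -rowE.
  by rewrite !mxE big_ord1 !mxE -mulrA mulrCA [in LHS](mulrC (invmx _ _ _)).
have tr_delta j : \tr (delta_mx i j : 'M[F]_r) = (j == i)%:R.
  rewrite /mxtrace (bigD1 i) //= big1 => [|k ne_ki]; last first.
    by rewrite mxE (negPf ne_ki).
  by rewrite mxE eqxx addr0 eq_sym.
rewrite (bigD1 i) //= [X in _ + X]big1 ?addr0 => [|j ne_ji]; last first.
  rewrite big1 // => b _; rewrite sum_conj_projective_rep tr_delta (negPf ne_ji).
  by rewrite mulr0 mul0r mxE mul0rn mulr0.
rewrite sum_conj_projective_rep tr_delta eqxx mulr1 (bigD1 a) //=.
rewrite big1 => [|b ne_ba]; last by rewrite mxE eq_sym (negPf ne_ba) mulr0.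
by rewrite mxE eqxx addr0 mulrC.
Qed.

Hypothesis al_nd : nondegenerate_cocycle al.

(** On M = rho 1 only h = 1 contributes to the expansion, with coefficient
    r, so r = |G| / r. *)
Lemma card_schur_rep : #|G| = (r ^ 2)%N.
Proof.
have exp1 := projective_rep_expansion (rho 1%g).
have := congr1 (fun M => \tr (invmx (rho 1%g) *m M)) exp1.
rewrite (bigD1 1%g) //= big1 ?addr0 => [|h ne_h1]; last first.
  by rewrite mxtrace_projective_repVM // eq_sym (negPf ne_h1) scale0r.
rewrite -!scalemxAr !mxtraceZ mxtrace_projective_repVM // eqxx mulfVK ?degree_neq0 //.
by rewrite -natrM => /(pchar0_natr_inj charF).
Qed.

(** The coordinate of x at h is tr ((rho h)^-1 (tw_lift x)) / r. *)
Lemma tw_lift_bijective : bijective (tw_lift rho).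
Proof.
pose coefs M : twisted al := [ffun h => r%:R^-1 * \tr (invmx (rho h) *m M)].
exists coefs => [x | M].
  apply/ffunP => h; rewrite ffunE mulmx_sumr raddf_sum (bigD1 h) //=.
  rewrite big1 => [|g ne_gh]; rewrite -scalemxAr mxtraceZ mxtrace_projective_repVM //.
    by rewrite eqxx addr0 mulrCA mulVf ?mulr1 ?degree_neq0.
  by rewrite (negPf ne_gh) mulr0.
rewrite /tw_lift; under eq_bigr do rewrite ffunE -scalerA.
rewrite -scaler_sumr projective_rep_expansion scalerA card_schur_rep natrX.
by rewrite expr2 mulfK ?mulVf ?scale1r ?degree_neq0.
Qed.

End SchurRepresentation.

End ProjectiveRepresentations.

(** Induction on the degree, from the regular representation. Whether the
    commutant is scalar is a decidable inclusion of row spaces; if it is not,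
    one of the rows spanning the commutant is a matrix that is not scalar, and
    any of its eigenspaces carries a representation of smaller degree. *)
Lemma exists_schur_rep (F : closedFieldType) (G : finGroupType)
    (al : cocycle2 F G) :
  exists r (rho : G -> 'M[F]_r),
    [/\ (0 < r)%N, projective_rep al rho & scalar_commutant rho].
Proof.
suff red n : forall rho : G -> 'M[F]_n, (0 < n)%N -> projective_rep al rho ->
  exists r (sigma : G -> 'M[F]_r),
    [/\ (0 < r)%N, projective_rep al sigma & scalar_commutant sigma].
  apply: red (regular_rep_projective al).
  by apply/card_gt0P; exists 1%g.
elim/ltn_ind: n => n IHn rho n_gt0 rhoP.
pose E : 'M[F]_(#|G|, n * n) := \matrix_i mxvec (rho (enum_val i)).
have [sC | /row_subPn[i]] := boolP ('C(E) <= mxvec (1%:M : 'M_n))%MS.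
  exists n, rho; split=> // A comA.
  have /sub_rVP[a] : (mxvec A <= mxvec (1%:M : 'M[F]_n))%MS.
    apply: submx_trans sC; apply/cent_rowP => i /=.
    by rewrite rowK mxvecK comA.
  by rewrite -linearZ => /(can_inj mxvecK) ->; exists a; rewrite scalemx1.
set A := vec_mx (row i 'C(E)%MS) => A_nscal.
have comA g : comm_mx A (rho g).
  have /cent_rowP/(_ (enum_rank g)) : (A \in 'C(E))%MS by rewrite vec_mxK row_sub.
  by rewrite /= rowK mxvecK enum_rankK.
have /closed_rootP[a] : size (char_poly A) != 1%N.
  by rewrite size_char_poly eqSS -lt0n.
rewrite -eigenvalue_root_char => eigA.
(* An eigenspace of full rank would make A scalar. *)
have rank_lt : (\rank (eigenspace A a) < n)%N.
  rewrite ltn_neqAle rank_leq_row andbT; apply: contra A_nscal => rn.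
  have /eigenspaceP : (1%:M <= eigenspace A a)%MS by rewrite sub1mx.
  rewrite mul1mx -[row i _]vec_mxK -/A => ->.
  by rewrite linearZ scalemx_sub.
apply: (IHn _ rank_lt (fun g => row_base (eigenspace A a) *m rho g *m
  pinvmx (row_base (eigenspace A a)))).
  by rewrite lt0n mxrank_eq0.
apply: projective_subrep => //; first exact: row_base_free.
move=> g; rewrite stablemx_row_base.
exact: comm_mx_stable_eigenspace.
Qed.

Theorem corollary15 (F : closedFieldType) (charF : [pchar F] =i pred0)
    (G : finGroupType) (A : algType F) (A_ : G -> {pred A})
    (theta : commutation_function F G)
    (regA : is_regular_grading A_ theta)
    (ndA : nondegenerate_commutation theta)
    (theta_gg : forall g : G, comm2 theta g g = 1)
    (alpha : cocycle2 F G)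
    (alpha_theta : is_regular_grading (tw_component (al := alpha)) theta) :
  exists (r : nat) (cardG : #|G| = (r ^ 2)%N),
    (exists phi : {lrmorphism twisted alpha -> 'M[F]_r}, bijective phi) /\
    (forall phi : {lrmorphism twisted alpha -> 'M[F]_r}, bijective phi ->
      \det (block_matrix cardG phi (commutation_matrix alpha)) = (r ^ (r ^ 3))%:R
      \/
      \det (block_matrix cardG phi (commutation_matrix alpha)) = - (r ^ (r ^ 3))%:R).
Proof.
have al_nd := nondegenerate_cocycleP alpha_theta ndA.
have [r [rho [r_gt0 rhoP rho_schur]]] := exists_schur_rep alpha.
have cardG := card_schur_rep charF r_gt0 rhoP rho_schur al_nd.
exists r, cardG; split=> [|phi _].
  have [phi phiE] := tw_lift_lrmorphism rhoP.
  exists phi; apply: eq_bij (tw_lift_bijective charF r_gt0 rhoP rho_schur al_nd) _ _.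
  by move=> x; rewrite phiE.
have sqr_r : #|G|%:R ^+ (r ^ 3) = (r ^ (r ^ 3))%:R ^+ 2 :> F.
  by rewrite cardG !natrX -!exprM mulnC.
have MM := commutation_matrix_sqr al_nd; rewrite -scaler_nat in MM.
have /eqP := det_block_matrix_sqr cardG phi MM.
by rewrite sqr_r eqf_sqr => /orP[] /eqP ->; [left | right].
Qed.
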